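(* Let $f:\mathbb{R}^n\to\mathbb{R}^n$ be a polynomial vector field with $f(0)=0$ and consider the system $\dot x=f(x)$. Suppose there exists a polynomial $V=V(x_1,\ldots,x_n)$ such that $t.h.c.(V)$ and $-\dot V=-\langle\nabla V(x),f(x)\rangle$ are both sums of squares and both positive definite. Then the origin is globally asymptotically stable. Moreover, the condition ''$t.h.c.(V)$ is a sum of squares'' is never more conservative, and can potentially be less conservative, than the condition ''$V$ is a sum of squares''; that is, for every real polynomial $V$, if $V$ is a sum of squares then $t.h.c.(V)$ is a sum of squares, while there exist real polynomials $V$ for which $t.h.c.(V)$ is a sum of squares but $V$ is not.
   Context: The top homogeneous component $t.h.c.(p)$ of a polynomial $p$ is the homogeneous polynomial formed by the collection of the highest-degree monomials (with their coefficients) of $p$. A function $V:\mathbb{R}^n\to\mathbb{R}$ is positive definite if $V(x)>0$ for all $x\neq 0$. A polynomial is a sum of squares (sos) if it equals $\sum_i q_i^2$ for finitely many real polynomials $q_i$. The origin is globally asymptotically stable for $\dot x=f(x)$ if it is stable in the sense of Lyapunov and every trajectory converges to the origin as $t\to\infty$. *)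

(* Defs.v *)
From HB Require Import structures.
From mathcomp Require Import all_boot all_order all_algebra.
From mathcomp Require Import all_classical all_reals all_analysis.
(* The notations of mpoly clash with those of mathcomp-analysis, hence
   [mpoly n R] below for the ring of polynomials in n variables over R. *)
From mathcomp Require Import -(notations) mpoly.

Set Implicit Arguments.
Unset Strict Implicit.
Unset Printing Implicit Defensive.

Import Order.TTheory GRing.Theory Num.Theory.
Import numFieldNormedType.Exports.

Local Open Scope classical_set_scope.
Local Open Scope ring_scope.

(* [(msize p).-1] is the degree of p; for p = 0 the result is 0. *)
Definition thc (R : nzRingType) (n : nat) (p : mpoly n R) : mpoly n R :=
  pihomog mdeg (msize p).-1 p.

Definition sos (R : nzRingType) (n : nat) (p : mpoly n R) : Prop :=
  exists s : seq (mpoly n R), p = \sum_(q <- s) q ^+ 2.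

Definition peval (R : nzRingType) (n : nat) (p : mpoly n R) (x : 'rV[R]_n) : R :=
  meval (x ord0) p.

(* Nothing is required at the origin. *)
Definition posdef (R : numDomainType) (n : nat) (V : 'rV[R]_n -> R) : Prop :=
  forall x : 'rV[R]_n, x != 0 -> 0 < V x.

Definition vfield (R : nzRingType) (n : nat) (f : 'I_n -> mpoly n R)
    (x : 'rV[R]_n) : 'rV[R]_n :=
  \row_(i < n) peval (f i) x.

Definition Vdot (R : nzRingType) (n : nat) (V : mpoly n R)
    (f : 'I_n -> mpoly n R) : mpoly n R :=
  \sum_(i < n) mderiv i V * f i.

(* Only the values of x on [0, +oo[ matter. Continuity at 0 together with the
   equation for t > 0 gives the one-sided derivative at t = 0. *)
Definition trajectory (R : realType) (n : nat) (F : 'rV[R]_n -> 'rV[R]_n)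
    (x : R -> 'rV[R]_n) : Prop :=
  {within `[0, +oo[, continuous x} /\
  forall t : R, 0 < t -> is_derive t 1 x (F (x t)).

(* The norm on 'rV[R]_n is the sup norm; the notion does not depend on the
   choice of the norm. *)
Definition lyapunov_stable (R : realType) (n : nat)
    (F : 'rV[R]_n -> 'rV[R]_n) : Prop :=
  forall e : R, 0 < e -> exists2 d : R, 0 < d &
    forall x : R -> 'rV[R]_n, trajectory F x -> `|x 0| < d ->
      forall t : R, 0 <= t -> `|x t| < e.

(* The second clause excludes finite escape times, which the quantification
   over trajectories defined on all of [0, +oo[ would otherwise ignore: when
   solutions are unique (F locally Lipschitz, e.g. polynomial), it says that
   every maximal solution is defined for all t >= 0. *)
Definition globally_asymptotically_stable (R : realType) (n : nat)
    (F : 'rV[R]_n -> 'rV[R]_n) : Prop :=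
  [/\ lyapunov_stable F,
      forall x0 : 'rV[R]_n, exists2 x : R -> 'rV[R]_n,
        trajectory F x & x 0 = x0 &
      forall x : R -> 'rV[R]_n, trajectory F x ->
        x t @[t --> +oo%R] --> (0 : 'rV[R]_n)].

(* Main.v *)
Require Import Defs.
From mathcomp Require Import all_boot all_order all_algebra.
From mathcomp Require Import all_classical all_reals all_analysis.
From mathcomp Require Import -(notations) mpoly.
From mathcomp Require Import ring lra.
Import Order.TTheory GRing.Theory Num.Theory.
Import numFieldNormedType.Exports.
Local Open Scope classical_set_scope.
Local Open Scope ring_scope.
Set Implicit Arguments.
Unset Strict Implicit.
Unset Printing Implicit Defensive.

(** Write V' for the derivative of V along the vector field F.

Stability.  Off a large ball the top homogeneous component of V, which is
bounded below by a positive constant on the unit sphere, dominates the terms of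
lower degree, so V is coercive ([thc_posdef_coercive]); in positive dimension V
cannot be constant, for then V' would vanish ([lyapunov_candidate_coercive]).
A coercive continuous function has a global minimiser, and there the gradient of V, hence
V', vanishes ([Vdot_minimizer]); as V' < 0 off the origin, the origin is the
only global minimiser.  So V - V(0) is a strict Lyapunov function with compact
sublevel sets, and Lyapunov's direct method applies:
- for every e > 0 some value m > V(0) is such that V < m forces the norm to be
  below e ([lyapunov_gap]); since V does not increase along trajectories, this
  gives stability ([lyapunov_is_stable]);
- a trajectory on which V stayed at or above m would live in a compact set
  where V' is bounded by a negative constant, so that V would tend to -oo; hence
  V falls below every such m and the trajectory converges to the origin
  ([lyapunov_attractive]);
- a trajectory from x0 cannot leave the bounded set where V is at most V(x0),
  so it exists for all time ([lyapunov_global_solution]).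

Global existence is reduced to the case of a globally Lipschitz field by
composing F with the coordinatewise truncation to a large box
([apriori_bound_global_solution]).  That case is Picard iteration
([lipschitz_global_solution]), in which the integral equation is replaced by
the choice of antiderivatives and all the integral estimates by one comparison
with an exponential ([exp_growth_le]).

Sums of squares.  If V is a sum of squares of polynomials q and m is the
largest leading monomial of the q's, then the coefficient of V at m + m is a
sum of squares that are not all zero.  So the top components of the q's of
maximal degree do not cancel and the sum of their squares is the top component
of V ([sos_degree], [sos_thc]).  The converse fails for X^2 - 1, which is
negative at the origin ([thc_sos_not_sos]). *)

(** * Sums of squares and top homogeneous components *)

Lemma msizeM_bound (R : idomainType) n (p q : mpoly n R) a b :
  (msize p <= a)%N -> (msize q <= b.+1)%N -> (msize (p * q) <= a + b)%N.
Proof.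
move=> pa qb.
have [->|p0] := eqVneq p 0; first by rewrite mul0r mmeasure0.
have [->|q0] := eqVneq q 0; first by rewrite mulr0 mmeasure0.
rewrite msizeM//; apply: leq_trans (_ : (a + b.+1).-1 <= _)%N.
  by rewrite -!subn1 leq_sub2r// leq_add.
by rewrite addnS.
Qed.

Lemma pihomog_msize0 (R : nzRingType) n (p : mpoly n R) d :
  (msize p <= d)%N -> pihomog mdeg d p = 0.
Proof.
move=> pd; rewrite pihomogE big_seq_cond big_pred0// => m.
apply/negP => /andP[mp /eqP md].
by have := msize_mdeg_lt mp; rewrite md ltnNge pd.
Qed.

Lemma msize_sub_pihomog (R : nzRingType) n (p : mpoly n R) d :
  (msize p <= d.+1)%N -> (msize (p - pihomog mdeg d p) <= d)%N.
Proof.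
move=> pd; rewrite {1}(pihomog_partitionE pd) big_ord_recr/= addrK.
apply: leq_trans (msize_sum _ _ _) _; apply/bigmax_leqP_seq => i _ _.
rewrite msizeE; apply/bigmax_leqP_seq => m mp _.
by have /dhomogP/(_ _ mp) -> := pihomogP mdeg i p.
Qed.

(** Let h be the component of degree d of p and r = p - h, of degree less than
d.  Then p^2 = h^2 + r (h + p), whose last product has degree less than 2d. *)
Lemma pihomog_sqr (R : idomainType) n (p : mpoly n R) d :
  (msize p <= d.+1)%N -> pihomog mdeg (d + d) (p ^+ 2) = pihomog mdeg d p ^+ 2.
Proof.
move=> pd; have rd := msize_sub_pihomog pd.
set h := pihomog _ _ p in rd *; set r := p - h in rd.
have -> : p ^+ 2 = h ^+ 2 + r * (h + p).
  by rewrite /r [h + p]addrC -subr_sqr addrC subrK.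
rewrite pihomogD pihomog_dE; last by rewrite expr2 dhomogM// pihomogP.
rewrite [X in _ + X]pihomog_msize0 ?addr0//.
apply: msizeM_bound => //.
rewrite (leq_trans (msizeD_le _ _))// geq_max pd andbT.
have -> : h = p - r by rewrite /r opprB addrC subrK.
rewrite (leq_trans (msizeD_le _ _))// geq_max pd/= mmeasureN.
exact: leq_trans rd _.
Qed.

Lemma max_mlead (R : nzRingType) n (q0 : mpoly n R) (s : seq (mpoly n R)) :
  exists2 q, q \in q0 :: s & forall p, p \in q0 :: s -> (mlead p <= mlead q)%O.
Proof.
elim: s q0 => [|q1 s IH] q0.
  by exists q0; rewrite ?mem_head// => p; rewrite inE => /eqP->.
have [q qs qmax] := IH q1.
have [le01|lt10] := leP (mlead q0) (mlead q).
  exists q; first by rewrite inE qs orbT.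
  by move=> p; rewrite inE => /orP[/eqP->//|/qmax].
exists q0; rewrite ?mem_head// => p; rewrite inE => /orP[/eqP->//|/qmax].
by move=> /le_trans; apply; exact: ltW.
Qed.

(** No cancellation can occur at the largest leading monomial m: the
coefficient at m + m of each square is the square of the coefficient at m, and
over an ordered ring these squares do not add up to 0. *)
Lemma sos_degree (R : realDomainType) n (s : seq (mpoly n R)) :
  \sum_(q <- s) q ^+ 2 != 0 -> exists d,
  msize (\sum_(q <- s) q ^+ 2) = (d + d).+1 /\
  forall q, q \in s -> (msize q <= d.+1)%N.
Proof.
set V := \sum_(q <- s) _.
have VE : V = \sum_(q <- [seq q <- s | q != 0]) q ^+ 2.
  rewrite big_filter [LHS](bigID (fun q => q == 0))/= big1 ?add0r//.
  by move=> q /eqP->; rewrite expr0n.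
case sE : [seq q <- s | q != 0] => [|q0 s'] V0.
  by move: V0; rewrite VE sE big_nil eqxx.
have [q qs qmax] := max_mlead q0 s'.
rewrite -sE in qs qmax; pose m := mlead q.
have q_neq0 : q != 0 by move: qs; rewrite mem_filter => /andP[].
have szs p : p \in s -> (msize p <= (mdeg m).+1)%N.
  move=> ps; have [->|p0] := eqVneq p 0; first by rewrite mmeasure0.
  by rewrite -mlead_deg// ltnS lemc_mdeg// qmax// mem_filter p0.
exists (mdeg m); split=> //; apply/eqP; rewrite eqn_leq; apply/andP; split.
  rewrite (leq_trans (msize_sum _ _ _))//; apply/bigmax_leqP_seq => p ps _.
  by rewrite expr2 -addSn; apply: msizeM_bound; apply: szs.
have VmE : mcoeff (mnm_add m m) V =
    \sum_(p <- [seq q <- s | q != 0]) mcoeff m p ^+ 2.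
  rewrite VE raddf_sum/= big_seq [RHS]big_seq; apply: eq_bigr => p ps.
  by rewrite expr2 mleadcMW ?qmax// -expr2.
have mV : mnm_add m m \in msupp V.
  rewrite mcoeff_msupp VmE (big_rem q)//= gt_eqF// ltr_wpDr//.
    by apply: sumr_ge0 => p _; exact: sqr_ge0.
  by rewrite exprn_even_gt0//= mleadc_eq0.
by have := msize_mdeg_lt mV; rewrite mdegD.
Qed.

Lemma sos_thc (R : realDomainType) n (V : mpoly n R) : sos V -> sos (thc V).
Proof.
move=> [s VE]; have [V0|V0] := eqVneq V 0.
  by exists [::]; rewrite big_nil /thc V0 pihomog0.
rewrite VE in V0; have [d [szV szs]] := sos_degree V0.
exists [seq pihomog mdeg d q | q <- s].
rewrite /thc VE szV/= raddf_sum/= big_map big_seq [RHS]big_seq.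
by apply: eq_bigr => q /szs; apply: pihomog_sqr.
Qed.

Lemma thc_sos_not_sos (R : realDomainType) n : (0 < n)%N ->
  exists V : mpoly n R, sos (thc V) /\ ~ sos V.
Proof.
case: n => // n _; pose X := mpolyX R (mnm1 (@ord0 n)).
have szX2 : msize (X ^+ 2) = 3.
  by rewrite expr2 /X -mpolyXD msizeX mdegD !mdeg1.
have szV : msize (X ^+ 2 - 1) = 3.
  apply/eqP; rewrite eqn_leq.
  rewrite (leq_trans (msizeD_le _ _)) ?szX2 ?mmeasureN ?msize1//=.
  have := msizeD_le (X ^+ 2 - 1) 1.
  by rewrite subrK szX2 msize1 leq_max orbF.
exists (X ^+ 2 - 1); split.
  exists [:: X]; rewrite big_seq1 /thc szV/= pihomogB.
  rewrite [X in _ - X]pihomog_msize0 ?msize1// subr0 pihomog_dE//.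
  by rewrite expr2 (@dhomogM _ _ _ 1 _ 1)// dhomogX/= mdeg1.
move=> [s /(congr1 (meval (fun=> 0)))].
rewrite rmorphB rmorphXn/= rmorph1 mevalXU expr0n/= sub0r rmorph_sum/= => sE.
suff : (0 : R) <= -1 by rewrite oppr_ge0 ler10.
by rewrite sE; apply: sumr_ge0 => q _; rewrite rmorphXn sqr_ge0.
Qed.

(** * Evaluation of polynomials *)

(** Evaluation is a ring morphism and the properties of it proved below are
inherited by sums and products, so induction on ring expressions fits it better
than adding monomials one at a time. *)
Lemma mpoly_ring_ind (R : nzRingType) n (P : mpoly n R -> Prop) :
  (forall c, P (mpolyC n c)) -> (forall i, P (mpolyX R (mnm1 i))) ->
  (forall p q, P p -> P q -> P (p + q)) ->
  (forall p q, P p -> P q -> P (p * q)) -> forall p, P p.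
Proof.
move=> PC PX PD PM; apply: mpolyind; first by rewrite -mpolyC0.
move=> c m p _ _ Pp; apply: (PD) => //; rewrite -mul_mpolyC; apply: (PM) => //.
rewrite mpolyXE_id; elim/big_ind : _ => //; first by rewrite -mpolyC1.
by move=> i _; elim: (m i) => [|k IH]; rewrite ?expr0 -?mpolyC1// exprS;
  apply: PM.
Qed.

Lemma pevalC (R : nzRingType) n c (x : 'rV[R]_n) : peval (mpolyC n c) x = c.
Proof. exact: mevalC. Qed.

Lemma pevalX (R : nzRingType) n i (x : 'rV[R]_n) :
  peval (mpolyX R (mnm1 i)) x = x ord0 i.
Proof. exact: mevalXU. Qed.

Lemma pevalD (R : nzRingType) n (p q : mpoly n R) x :
  peval (p + q) x = peval p x + peval q x.
Proof. exact: mevalD. Qed.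

Lemma pevalM (R : comNzRingType) n (p q : mpoly n R) x :
  peval (p * q) x = peval p x * peval q x.
Proof. exact: mevalM. Qed.

Lemma peval_continuous (R : realType) n (p : mpoly n R) : continuous (peval p).
Proof.
elim/mpoly_ring_ind : p => [c|i|p q cp cq|p q cp cq] x.
- by rewrite (funext (pevalC c)); exact: cst_continuous.
- by rewrite (funext (pevalX i)); exact: coord_continuous.
- by rewrite (funext (pevalD p q));
  exact: (@continuousD R R^o _ _ _ x (cp x) (cq x)).
- by rewrite (funext (pevalM p q));
  exact: (@continuousM R _ _ _ x (cp x) (cq x)).
Qed.

Lemma is_derive_coord (R : realType) n (x : R -> 'rV[R]_n) (t : R)
    (v : 'rV[R]_n) i :
  is_derive t 1 x v -> is_derive t 1 (fun s => x s ord0 i) (v ord0 i).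
Proof.
move=> dx; have xt : derivable x t 1 by exact: ex_derive.
split; first exact: (derivable_mxP x t 1).1 xt ord0 i.
by rewrite -(@derive_val _ _ _ _ _ _ _ dx) derive_mx// mxE.
Qed.

Lemma is_derive_row (R : realType) n (x : R -> 'rV[R]_n) (t : R)
    (v : 'rV[R]_n) :
  (forall i, is_derive t 1 (fun s => x s ord0 i) (v ord0 i)) ->
  is_derive t 1 x v.
Proof.
move=> dx; have xt : derivable x t 1.
  by apply/derivable_mxP => i j; rewrite (ord1 i); apply: ex_derive.
split=> //; apply/rowP => i; rewrite derive_mx// mxE.
exact: derive_val.
Qed.

Lemma is_derive_peval (R : realType) n (p : mpoly n R)
    (x : R -> 'rV[R]_n) (t : R) (v : 'rV[R]_n) :
  is_derive t 1 x v ->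
  is_derive t 1 (fun s => peval p (x s))
    (\sum_i peval (mderiv i p) (x t) * v ord0 i).
Proof.
move=> dx; elim/mpoly_ring_ind : p => [c|j|p q dp dq|p q dp dq].
- rewrite (eq_fun (fun s => pevalC c (x s))).
  rewrite big1 => [|i _]; last by rewrite mderivC /peval meval0 mul0r.
  exact: is_derive_cst.
- rewrite (eq_fun (fun s => pevalX j (x s))).
  rewrite (bigD1 j)//= big1 ?addr0 => [|i ij].
    rewrite mderivX mnm1E eqxx scale1r.
    have -> : mnm_sub (mnm1 j) (mnm1 j) = mnm0.
      by apply/mnmP => k; rewrite mnmBE mnm0E subnn.
    by rewrite mpolyX0 /peval meval1 mul1r; exact: is_derive_coord.
  by rewrite mderivX mnm1E eq_sym (negbTE ij) scale0r /peval meval0 mul0r.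
- rewrite (eq_fun (fun s => pevalD p q (x s))).
  under eq_bigr do rewrite mderivD pevalD mulrDl.
  by rewrite big_split; exact: is_deriveD.
- rewrite (eq_fun (fun s => pevalM p q (x s))).
  rewrite [X in is_derive _ _ _ X](_ : _ =
      peval p (x t) *: (\sum_i peval (mderiv i q) (x t) * v ord0 i) +
      peval q (x t) *: (\sum_i peval (mderiv i p) (x t) * v ord0 i)).
    exact: is_deriveM.
  rewrite /GRing.scale/= !mulr_sumr -big_split/=; apply: eq_bigr => i _.
  by rewrite mderivM pevalD !pevalM; ring.
Qed.

Lemma coord_norm_le (R : realType) n (x : 'rV[R]_n) i : `|x ord0 i| <= `|x|.
Proof.
rewrite [leRHS]/Num.Def.normr/= mx_normrE.
exact: (le_bigmax _ (fun ij : 'I_1 * 'I_n => `|x ij.1 ij.2|) (ord0, i)).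
Qed.

Lemma row_norm_le (R : realType) n (x : 'rV[R]_n) e :
  0 <= e -> (forall i, `|x ord0 i| <= e) -> `|x| <= e.
Proof.
move=> e0 xe; rewrite /Num.Def.normr/= mx_normrE.
rewrite (bigmax_le _ e0)// => -[i j] _ /=.
by rewrite (ord1 i); exact: xe.
Qed.

Lemma peval_bounded (R : realType) n (p : mpoly n R) M : exists2 B, 0 <= B &
  forall x, `|x| <= M -> `|peval p x| <= B.
Proof.
elim/mpoly_ring_ind : p =>
  [c|i|p q [B B0 pB] [C C0 qC]|p q [B B0 pB] [C C0 qC]].
- by exists `|c| => // x _; rewrite pevalC.
- exists `|M| => // x xM; rewrite pevalX.
  by rewrite (le_trans (coord_norm_le x i))// (le_trans xM)// ler_norm.
- exists (B + C); first exact: addr_ge0.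
  by move=> x xM; rewrite pevalD (le_trans (ler_normD _ _))// lerD ?pB ?qC.
- exists (B * C); first exact: mulr_ge0.
  by move=> x xM; rewrite pevalM normrM ler_pM ?pB ?qC.
Qed.

Lemma peval_lipschitz (R : realType) n (p : mpoly n R) M : exists2 K, 0 <= K &
  forall x y, `|x| <= M -> `|y| <= M ->
    `|peval p x - peval p y| <= K * `|x - y|.
Proof.
elim/mpoly_ring_ind : p =>
  [c|i|p q [K K0 pK] [L L0 qL]|p q [K K0 pK] [L L0 qL]].
- by exists 0 => // x y _ _; rewrite !pevalC subrr normr0 mul0r.
- exists 1 => // x y _ _; rewrite !pevalX mul1r.
  by apply: le_trans (coord_norm_le (x - y) i); rewrite !mxE.
- exists (K + L); first exact: addr_ge0.
  move=> x y xM yM; rewrite !pevalD opprD addrACA mulrDl.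
  rewrite (le_trans (ler_normD _ _))// lerD ?pK ?qL//.
- have [B B0 pB] := peval_bounded p M; have [C C0 qC] := peval_bounded q M.
  exists (B * L + C * K); first by rewrite addr_ge0// mulr_ge0.
  move=> x y xM yM; rewrite !pevalM.
  have -> : peval p x * peval q x - peval p y * peval q y =
    peval p x * (peval q x - peval q y) +
    peval q y * (peval p x - peval p y) by ring.
  rewrite (le_trans (ler_normD _ _))// !normrM mulrDl -!mulrA.
  by rewrite lerD// ler_pM ?pB ?qC ?pK ?qL.
Qed.

Lemma peval_homog (R : realType) n (p : mpoly n R) d a x :
  p \is ishomog1 d mdeg -> peval p (a *: x) = a ^+ d * peval p x.
Proof.
move=> /dhomogP hp; rewrite /peval !mevalE mulr_sumr.
rewrite big_seq [RHS]big_seq; apply: eq_bigr => m /hp <-.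
under eq_bigr do rewrite mxE exprMn.
by rewrite big_split/= prodrXr -mdegE mulrCA.
Qed.

Lemma peval_growth (R : realType) n (p : mpoly n R) d :
  (msize p <= d.+1)%N -> exists2 B, 0 <= B &
  forall x, 1 <= `|x| -> `|peval p x| <= B * `|x| ^+ d.
Proof.
move=> pd; exists (\sum_(m <- msupp p) `|mcoeff m p|); first exact: sumr_ge0.
move=> x x1; rewrite /peval mevalE mulr_suml (le_trans (ler_norm_sum _ _ _))//.
rewrite big_seq [leRHS]big_seq; apply: ler_sum => m mp.
rewrite normrM ler_wpM2l// normr_prod.
apply: (@le_trans _ _ (\prod_(i < n) `|x| ^+ m i)).
  apply: ler_prod => i _; rewrite normr_ge0/= normrX lerXn2r ?nnegrE//.
  exact: coord_norm_le.
rewrite prodrXr -mdegE ler_weXn2l// -ltnS.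
exact: leq_trans (msize_mdeg_lt mp) pd.
Qed.

Definition coercive (R : realType) n (W : 'rV[R]_n -> R) :=
  forall A, exists r, forall x, r <= `|x| -> A <= W x.

(** The two uses are the unit sphere (a = b = 1) and the closed shells and
balls on which minima of Lyapunov functions are taken. *)
Lemma norm_shell_compact (R : realType) n (a b : R) :
  compact [set x : 'rV[R]_n | a <= `|x| <= b].
Proof.
apply: bounded_closed_compact.
  exists b; split=> [|M bM x /= /andP[_ xb]]; first exact: num_real.
  exact: le_trans xb (ltW bM).
have -> : [set x : 'rV[R]_n | a <= `|x| <= b] = (fun x => `|x|) @^-1` `[a, b].
  by apply/seteqP; split=> x /=; rewrite in_itv.
apply: closed_comp; last exact: itv_closed.
by move=> x _; exact: norm_continuous.
Qed.

(** With c > 0 the minimum of the top component, of degree d + 1, on the unit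
sphere, V(x) is at least c r^(d+1) - B r^d = r^d (c r - B) when |x| = r >= 1. *)
Lemma thc_posdef_coercive (R : realType) n (V : mpoly n R) :
  (1 < msize V)%N -> posdef (peval (thc V)) -> coercive (peval V).
Proof.
move=> V1 hV A; pose d := (msize V).-2.
have Vd : msize V = d.+2 by rewrite /d; case: (msize V) V1 => [|[]].
pose S := [set x : 'rV[R]_n | 1 <= `|x| <= 1].
have normalize (x : 'rV[R]_n) : 1 <= `|x| -> S (`|x|^-1 *: x).
  move=> x1; rewrite /S/= normrZ normfV normr_id mulVf ?lexx//.
  by rewrite gt_eqF// (lt_le_trans _ x1).
have [S0|/forallNP S0] := pselect (S !=set0); last first.
  by exists 1 => x /normalize /S0.
have [u /set_mem Su umin] := EVT_min_rV S0 (@norm_shell_compact R n 1 1)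
  (continuous_subspaceT (@peval_continuous _ _ (thc V))).
set c := peval (thc V) u in umin.
have c0 : 0 < c.
  by apply: hV; rewrite -normr_gt0; move: Su => /andP[+ _]; exact: lt_le_trans.
have Wd : (msize (V - thc V) <= d.+1)%N.
  by rewrite /thc Vd/= msize_sub_pihomog// Vd.
have [B B0 WB] := peval_growth Wd.
exists (Num.max 1 ((`|A| + B) / c)) => x.
rewrite ge_max ler_pdivrMr// => /andP[x1 xA].
have -> : V = thc V + (V - thc V) by rewrite addrC subrK.
rewrite pevalD.
have xn0 : `|x| != 0 by rewrite gt_eqF// (lt_le_trans _ x1).
have top : c * `|x| ^+ d.+1 <= peval (thc V) x.
  have -> : x = `|x| *: (`|x|^-1 *: x) by rewrite scalerA mulfV// scale1r.
  rewrite (@peval_homog _ _ _ d.+1); last by rewrite /thc Vd; exact: pihomogP.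
  rewrite normrZ normr_id normrZ normfV normr_id mulVf// mulr1 mulrC.
  by rewrite ler_wpM2l ?exprn_ge0// umin// inE; exact: normalize.
have low : - (B * `|x| ^+ d) <= peval (V - thc V) x.
  by have := WB x x1; rewrite ler_norml => /andP[].
apply: le_trans (lerD top low).
have -> : c * `|x| ^+ d.+1 - B * `|x| ^+ d = `|x| ^+ d * (`|x| * c - B).
  by rewrite exprS; move: (`|x| ^+ d) => y; ring.
apply: (le_trans (ler_norm A)).
rewrite -[leLHS]mul1r ler_pM ?exprn_ege1// lerBrDr//.
Qed.

(** * Global solutions of ordinary differential equations *)

Lemma increment_le (R : realType) (g dg : R -> R) (a b k : R) : a <= b ->
  (forall t, t \in `]a, b[ -> is_derive t 1 g (dg t)) ->
  {within `[a, b], continuous g} ->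
  (forall t, t \in `]a, b[ -> dg t <= k) -> g b - g a <= k * (b - a).
Proof.
rewrite le_eqVlt => /predU1P[<- _ _ _|ab dgP cg dgk].
  by rewrite !subrr mulr0.
have [c cab ->] := MVT ab dgP cg.
by rewrite ler_wpM2r ?dgk// subr_ge0 ltW.
Qed.

Lemma continuous_row (R : realType) (T : topologicalType) n
    (x : T -> 'rV[R]_n) (t : T) :
  (forall i, continuous_at t (fun s => x s ord0 i)) -> {for t, continuous x}.
Proof.
move=> cx; apply/cvgrPdist_le => /= e e0.
near=> s; apply: row_norm_le; first exact: ltW.
move=> i; rewrite !mxE; move: i; near: s; apply: filter_forall => /= i.
exact: ((cvgrPdist_le _ _).1 (cx i)).
Unshelve. all: by end_near. Qed.

(** The primitive is the integral from -1, for which the derivative at every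
t > -1 is known; it is frozen at t <= 0 so as to be continuous everywhere. *)
Lemma continuous_antiderivative (R : realType) (g : R -> R) : continuous g ->
  exists G : R -> R, [/\ continuous G, forall t : R, t <= 0 -> G t = 0 &
    forall t : R, 0 < t -> is_derive t 1 G (g t)].
Proof.
move=> cg; pose mu := @lebesgue_measure R.
pose I (x : R) : R := (\int[mu]_(s in [set` `[-1, x]]) g s)%R.
have dI (x : R) : -1 < x -> is_derive x 1 I (g x).
  move=> x1; have ig : mu.-integrable `[-1, x + 1] (EFin \o g).
    apply: continuous_compact_integrable; first exact: segment_compact.
    exact: continuous_subspaceT.
  have x1' : x < x + 1 by rewrite ltrDl.
  have [dI I'] := continuous_FTC1_closed x1' ig x1 (cg x).
  by split=> //; rewrite -derive1E.
pose m t : R := Num.max t 0.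
have mE (t : R) : 0 < t -> \forall s \near t, s = m s.
  move=> t0; near=> s; rewrite /m max_l// ltW//; near: s.
  exact: lt_nbhsr.
exists (fun t => I (m t) - I 0); split=> [t|t t0|t t0].
- apply: cvgB; last exact: cvg_cst.
  apply: (@continuous_comp _ _ _ m I).
    by apply: continuous_max; [exact: cvg_id|exact: cvg_cst].
  apply/differentiable_continuous/derivable1_diffP.
  have : -1 < m t by rewrite /m lt_max ltrN10 orbT.
  move=> /dI dIm; exact: (@ex_derive _ _ _ _ _ _ _ dIm).
- by rewrite /m max_r// subrr.
- have d1 : is_derive t 1 (fun t => I t - I 0) (g t).
    rewrite -[g t]subr0; apply: is_deriveB; apply: dI.
    by rewrite (lt_trans _ t0)// ltrN10.
  apply: near_eq_is_derive d1; near=> s.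
  by congr (I _ - _); near: s; exact: mE.
Unshelve. all: by end_near. Qed.

Lemma curve_antiderivative (R : realType) n (y : R -> 'rV[R]_n)
    (x0 : 'rV[R]_n) :
  continuous y -> exists Y : R -> 'rV[R]_n,
  [/\ continuous Y, forall t : R, t <= 0 -> Y t = x0 &
    forall t : R, 0 < t -> is_derive t 1 Y (y t)].
Proof.
move=> cy.
have /choice[G GP] i : exists G : R -> R,
    [/\ continuous G, forall t : R, t <= 0 -> G t = 0 &
      forall t : R, 0 < t -> is_derive t 1 G (y t ord0 i)].
  apply: (@continuous_antiderivative _ (fun t => y t ord0 i)) => t.
  apply: (@continuous_comp _ _ _ y (fun v : 'rV[R]_n => v ord0 i)).
    exact: cy.
  exact: coord_continuous.
pose Y t : 'rV[R]_n := \row_i (x0 ord0 i + G i t).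
have YE i : (fun s => Y s ord0 i) = (fun s => x0 ord0 i + G i s).
  by apply/funext => s; rewrite mxE.
exists Y; split=> [t|t t0|t t0].
- apply: continuous_row => i; have [cG _ _] := GP i.
  rewrite YE.
  by apply: (@continuousD R R^o); [exact: cst_continuous|exact: cG].
- apply/rowP => i; rewrite mxE; have [_ G0 _] := GP i.
  by rewrite G0// addr0.
- apply: is_derive_row => i; have [_ _ dG] := GP i.
  rewrite YE.
  rewrite -[y t ord0 i]add0r; apply: is_deriveD; exact: dG.
Qed.

(** Both bounds have the same shape because l * exp (l t) is the derivative of
exp (l t): integrating the bound on the derivative gains the factor 1 / l. *)
Lemma exp_growth_le (R : realType) n (z w : R -> 'rV[R]_n) (c l : R) :
  continuous z -> z 0 = 0 -> (forall t : R, 0 < t -> is_derive t 1 z (w t)) ->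
  0 <= c -> (forall t : R, 0 < t -> `|w t| <= l * c * expR (l * t)) ->
  forall t : R, 0 <= t -> `|z t| <= c * expR (l * t).
Proof.
move=> cz z0 dz c0 wl t t0.
have dE (s : R) :
    is_derive s 1 (fun s => c * expR (l * s)) (l * c * expR (l * s)).
  have -> : l * c * expR (l * s) = c *: (expR (l * s) * (l *: 1)).
    by rewrite /GRing.scale/=; ring.
  apply: is_deriveZ; apply: (@is_derive1_comp _ expR (fun s => l * s)).
have cE : continuous (fun s : R => c * expR (l * s)).
  move=> s; apply/differentiable_continuous/derivable1_diffP.
  exact: (@ex_derive _ _ _ _ _ _ _ (dE s)).
apply: row_norm_le; first by rewrite mulr_ge0 ?expR_ge0.
have key (e : R) (i : 'I_n) : `|e| = 1 -> e * z t ord0 i <= c * expR (l * t).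
  move=> e1.
  pose h (s : R) : R := e * z s ord0 i - c * expR (l * s).
  suff : h t - h 0 <= 0 * (t - 0).
    rewrite /h z0 mxE mul0r mulr0 sub0r opprK mulr0 expR0 mulr1 => ht.
    by rewrite -subr_le0; apply: le_trans ht; rewrite lerDl.
  have dh (s : R) : 0 < s ->
      is_derive s 1 h (e * w s ord0 i - l * c * expR (l * s)).
    move=> s0; apply: is_deriveB.
    by apply: is_deriveZ; apply: is_derive_coord; exact: dz.
  pose dg (s : R) := e * w s ord0 i - l * c * expR (l * s).
  apply: (increment_le (dg := dg)) => //.
  - by move=> s; rewrite in_itv/= => /andP[s0 _]; exact: dh.
  - apply: continuous_subspaceT => s; rewrite /h; apply: cvgB.
      apply: cvgM; first exact: cvg_cst.
      apply: (@continuous_comp _ _ _ z (fun v : 'rV[R]_n => v ord0 i)).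
        exact: cz.
      exact: coord_continuous.
    exact: (cE s).
  - move=> s; rewrite in_itv/= => /andP[s0 _].
    rewrite subr_le0; apply: le_trans (wl _ s0).
    apply: le_trans (coord_norm_le _ i); apply: le_trans (ler_norm _) _.
    by rewrite normrM e1 mul1r.
move=> i; rewrite ler_norml lerNl.
have := key 1 i; have := key (-1) i.
by rewrite normrN normr1 mul1r mulN1r => -> // ->.
Qed.

Lemma geometric_lt (R : realType) (M e : R) :
  0 <= M -> 0 < e -> exists k, M / 2 ^+ k < e.
Proof.
move=> M0 e0; have : geometric M 2^-1 x @[x --> \oo] --> (0 : R).
  by apply: cvg_geometric; rewrite ger0_norm ?invr_ge0// invf_lt1// ltr1n.
move=> /cvgrPdist_lt/(_ _ e0)[k _ /(_ k (leqnn k))] /=.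
rewrite sub0r normrN exprVn ger0_norm; first by exists k.
by rewrite divr_ge0 ?exprn_ge0.
Qed.

(** The sum of the steps after the k-th is at most the tail of the geometric
series, 2 M / 2^k. *)
Lemma geometric_steps_cvg (R : realType) n (u : nat -> 'rV[R]_n) (M : R) :
  (forall k, `|u k.+1 - u k| <= M / 2 ^+ k) ->
  exists l, forall k, `|l - u k| <= 2 * M / 2 ^+ k.
Proof.
move=> uM; have M0 : 0 <= M.
  by have := uM 0; rewrite expr0 divr1; exact: le_trans.
have dist k j : `|u (j + k)%N - u k| <= 2 * M / 2 ^+ k - 2 * M / 2 ^+ (j + k).
  elim: j => [|j IH]; first by rewrite add0n !subrr normr0.
  rewrite addSn -(subrKA (u (j + k)%N)) (le_trans (ler_normD _ _))//.
  rewrite (le_trans (lerD (uM _) IH))// exprS.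
  have : (2 : R) ^+ (j + k) != 0 by rewrite expf_neq0.
  move: (2 ^+ (j + k)) (2 * M / 2 ^+ k) => a b a0.
  by rewrite le_eqVlt; apply/orP; left; apply/eqP; field.
have dist' k j : `|u (j + k)%N - u k| <= 2 * M / 2 ^+ k.
  by rewrite (le_trans (dist k j))// gerBl divr_ge0 ?mulr_ge0 ?exprn_ge0.
have : cvg (u @ \oo).
  apply/cauchy_cvgP; apply: cauchy_exP => e e0.
  have [k ke] := geometric_lt (mulr_ge0 (ler0n R 2) M0) e0.
  exists (u k); exists k => // j /= kj.
  rewrite mx_norm_ball /ball_/= distrC -(subnK kj).
  exact: le_lt_trans (dist' _ _) ke.
move=> /cvg_ex[l ul]; exists l => k.
have : u (j + k)%N @[j --> \oo] --> l by rewrite cvg_shiftn.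
move=> uk; have : `|u (j + k)%N - u k| @[j --> \oo] --> `|l - u k|.
  by apply: cvg_norm; apply: cvgB => //; exact: cvg_cst.
move=> /cvg_lim <-//; apply: limr_le; last by near=> j; exact: dist'.
apply/cvg_ex; exists `|l - u k|; apply: cvg_norm.
by apply: cvgB => //; exact: cvg_cst.
Unshelve. all: by end_near. Qed.

Lemma lipschitz_continuous (R : realType) (V W : normedModType R)
    (F : V -> W) (K : R) :
  (forall x y, `|F x - F y| <= K * `|x - y|) -> continuous F.
Proof.
move=> FK x; apply/cvgrPdist_lt => e e0.
near=> y; rewrite (le_lt_trans (FK x y))//.
apply: (@le_lt_trans _ _ ((`|K| + 1) * `|x - y|)).
  by rewrite ler_wpM2r// (le_trans (ler_norm K))// lerDl.
have K0 : 0 < `|K| + 1 by rewrite ltr_wpDl.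
rewrite mulrC -ltr_pdivlMr//; near: y.
have := @cvgr_dist_lt _ _ _ (nbhs x) _ id x.
by apply; [exact: cvg_id|rewrite divr_gt0].
Unshelve. all: by end_near. Qed.

(** Picard iteration.  Measured against exp (2 K t), each iteration halves the
distance between consecutive iterates, by [exp_growth_le] with l = 2 K: the
Lipschitz constant costs a factor K and integration gains 1 / (2 K).  So the
iterates converge to some x, uniformly on bounded time intervals.  Instead of
passing to the limit in the equation, one compares the iterates with an
antiderivative y of F o x, which therefore has the same limit. *)
Lemma lipschitz_global_solution (R : realType) n (F : 'rV[R]_n -> 'rV[R]_n)
    (K : R) (x0 : 'rV[R]_n) : 1 <= K ->
  (forall x y, `|F x - F y| <= K * `|x - y|) ->
  exists y : R -> 'rV[R]_n, [/\ continuous y, y 0 = x0 &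
    forall t : R, 0 < t -> is_derive t 1 y (F (y t))].
Proof.
move=> K1 FK; have cF := lipschitz_continuous FK.
have /choice[S SP] (x : R -> 'rV[R]_n) :
    exists Y : R -> 'rV[R]_n, continuous x ->
    [/\ continuous Y, forall t : R, t <= 0 -> Y t = x0 &
      forall t : R, 0 < t -> is_derive t 1 Y (F (x t))].
  have [cx|ncx] := pselect (continuous x); last by exists (fun=> 0).
  have cFx : continuous (F \o x).
    by move=> t; apply: continuous_comp; [exact: cx|exact: cF].
  by have [Y YP] := curve_antiderivative x0 cFx; exists Y.
(* S x is the antiderivative of F o x that starts at x0. *)
pose X k := iter k S (fun=> x0).
have cX k : continuous (X k).
  elim: k => [|k IH]; first by move=> t; exact: cst_continuous.
  by have [] := SP _ IH.
have X0 k t : t <= 0 -> X k t = x0.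
  by case: k => [//|k]; have [_ + _] := SP _ (cX k); apply.
have dX k (t : R) : 0 < t -> is_derive t 1 (X k.+1) (F (X k t)).
  by have [_ _ +] := SP _ (cX k); apply.
pose l := 2 * K; pose C := `|F x0|.
have step k t : 0 <= t -> `|X k.+1 t - X k t| <= C / 2 ^+ k * expR (l * t).
  elim: k t => [|k IH].
    apply: (@exp_growth_le _ _ _ (fun=> F x0)).
    - by move=> t; apply: continuousB; exact: cX.
    - by rewrite !X0// subrr.
    - move=> t t0; rewrite -[F x0]subr0.
      by apply: is_deriveB; exact: dX.
    - by rewrite divr_ge0 ?exprn_ge0 ?normr_ge0.
    - move=> t t0; rewrite expr0 divr1 -/C mulrAC ler_peMl ?normr_ge0//.
      rewrite -[leLHS]mulr1 ler_pM//; first by rewrite /l; lra.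
      by rewrite -expR0 ler_expR mulr_ge0 ?ltW// /l; lra.
  apply: (@exp_growth_le _ _ _ (fun t => F (X k.+1 t) - F (X k t))).
  - by move=> t; apply: continuousB; exact: cX.
  - by rewrite !X0// subrr.
  - by move=> t t0; apply: is_deriveB; exact: dX.
  - by rewrite divr_ge0 ?exprn_ge0 ?normr_ge0.
  - move=> t t0; apply: (le_trans (FK _ _)).
    have -> : l * (C / 2 ^+ k.+1) * expR (l * t) =
        K * (C / 2 ^+ k * expR (l * t)).
      have : (2 : R) ^+ k != 0 by rewrite expf_neq0.
      by rewrite /l exprS; move: (expR _) (2 ^+ k) => a b b0; field.
    by rewrite ler_wpM2l ?IH ?ltW//; lra.
have step' t k : `|X k.+1 t - X k t| <= (C * expR (l * `|t|)) / 2 ^+ k.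
  have [t0|t0] := leP 0 t; first by rewrite ger0_norm// mulrAC step.
  rewrite !X0 ?(ltW t0)// subrr normr0 divr_ge0 ?exprn_ge0//.
  by rewrite mulr_ge0 ?expR_ge0 ?normr_ge0.
have /choice[x xX] t := geometric_steps_cvg (step' t).
(* Locally uniform limit: the bound at s is controlled by the one at |t| + 1. *)
have cx : continuous x.
  move=> t; apply/cvgrPdist_lt => e e0.
  pose M := 2 * (C * expR (l * (`|t| + 1))).
  have M0 : 0 <= M by rewrite !mulr_ge0 ?expR_ge0 ?normr_ge0.
  have [k ke] : exists k, M / 2 ^+ k < e / 3.
    by apply: geometric_lt; rewrite // divr_gt0.
  have near_bound s : `|s| <= `|t| + 1 -> `|x s - X k s| < e / 3.
    move=> st; apply: le_lt_trans ke; apply: le_trans (xX s k) _.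
    rewrite ler_wpM2r ?invr_ge0 ?exprn_ge0// /M ler_wpM2l//.
    by rewrite ler_wpM2l ?normr_ge0// ler_expR ler_wpM2l// /l; lra.
  near=> s.
  have h1 : `|x t - X k t| < e / 3 by apply: near_bound; lra.
  have h2 : `|X k s - x s| < e / 3.
    rewrite distrC; apply: near_bound.
    have : `|t - s| < 1.
      near: s; apply: ((@cvgrPdist_lt _ _ _ (nbhs t) _ id t).1 _ 1 ltr01).
      exact: cvg_id.
    have := ler_normD (s - t) t; rewrite subrK distrC; lra.
  have h3 : `|X k t - X k s| < e / 3.
    near: s; have := (cvgrPdist_lt _ _).1 (cX k t); apply; lra.
  rewrite -(subrKA (X k t)) (le_lt_trans (ler_normD _ _))//.
  rewrite -(subrKA (X k s) (X k t)).
  have := ler_normD (X k t - X k s) (X k s - x s); lra.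
have cFx : continuous (F \o x).
  by move=> t; apply: continuous_comp; [exact: cx|exact: cF].
have [y [cy y0 dy]] := curve_antiderivative x0 cFx.
have yX k t : 0 <= t -> `|y t - X k.+1 t| <= C / 2 ^+ k * expR (l * t).
  move: t; apply: (@exp_growth_le _ _ _ (fun t => F (x t) - F (X k t))).
  - by move=> t; apply: continuousB; [exact: cy|exact: cX].
  - by rewrite y0// X0// subrr.
  - by move=> t t0; apply: is_deriveB; [exact: dy|exact: dX].
  - by rewrite divr_ge0 ?exprn_ge0 ?normr_ge0.
  - move=> t t0; apply: (le_trans (FK _ _)).
    have := xX t k; rewrite gtr0_norm// => h.
    have -> : l * (C / 2 ^+ k) * expR (l * t) =
        K * (2 * (C * expR (l * t)) / 2 ^+ k).
      have : (2 : R) ^+ k != 0 by rewrite expf_neq0.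
      by rewrite /l; move: (expR _) (2 ^+ k) => a b b0; field.
    by rewrite ler_wpM2l//; lra.
have yx t : 0 <= t -> y t = x t.
  move=> t0; apply/eqP; rewrite -subr_eq0 -normr_eq0; apply/negPn/negP => d0.
  have {}d0 : 0 < `|y t - x t| by rewrite lt_def d0 normr_ge0.
  pose M := C * expR (l * t).
  have M0 : 0 <= M by rewrite mulr_ge0 ?expR_ge0 ?normr_ge0.
  have [k] := geometric_lt (mulr_ge0 (ler0n R 2) M0) d0.
  apply/negP; rewrite -leNgt -(subrKA (X k.+1 t)) (le_trans (ler_normD _ _))//.
  have h1 := yX k t t0; rewrite mulrAC -/M in h1.
  have h2 := xX t k.+1; rewrite ger0_norm// -/M distrC in h2.
  have M2 : 2 * M / 2 ^+ k.+1 = M / 2 ^+ k.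
    have : (2 : R) ^+ k != 0 by rewrite expf_neq0.
    by rewrite exprS; move: (2 ^+ k) => b b0; field.
  rewrite M2 in h2; rewrite -mulrA; lra.
exists y; split=> //; first by rewrite y0.
by move=> t t0; rewrite (yx _ (ltW t0)); exact: dy.
Unshelve. all: by end_near. Qed.

(** A retraction onto the closed ball of radius M of the sup norm that does not
increase distances. *)
Definition clamp (R : realType) n (M : R) (x : 'rV[R]_n) : 'rV[R]_n :=
  \row_i Num.max (- M) (Num.min M (x ord0 i)).

Lemma clamp_norm (R : realType) n (M : R) (x : 'rV[R]_n) :
  0 <= M -> `|clamp M x| <= M.
Proof.
move=> M0; apply: row_norm_le => // i; rewrite mxE ler_norml le_max lexx/=.
by rewrite ge_max ge_min lexx andbT; lra.
Qed.

Lemma clamp_id (R : realType) n (M : R) (x : 'rV[R]_n) :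
  `|x| <= M -> clamp M x = x.
Proof.
move=> xM; apply/rowP => i; rewrite mxE.
have := le_trans (coord_norm_le x i) xM; rewrite ler_norml => /andP[lo hi].
by rewrite min_r// max_r.
Qed.

Lemma clamp_lipschitz (R : realType) n (M : R) (x y : 'rV[R]_n) : 0 <= M ->
  `|clamp M x - clamp M y| <= `|x - y|.
Proof.
move=> M0; apply: row_norm_le => // i; apply: le_trans (coord_norm_le _ i).
rewrite !mxE; move: (x ord0 i) (y ord0 i) => a b.
have := ler_norm (a - b); have := ler_norm (b - a); rewrite (distrC b a).
rewrite ler_norml; move: `|a - b| => c h1 h2.
rewrite /Num.max /Num.min.
by case: (ltP M a) => ?; case: (ltP M b) => ?; case: (ltP (- M) M) => ?;
  case: (ltP (- M) a) => ?; case: (ltP (- M) b) => ?; apply/andP; split; lra.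
Qed.

(** Solutions of the truncated field are global and solve the original
equation while they stay in the box.  At the first time T at which the norm
reached M, the a priori bound would still apply, and it says that the norm is
below M at T. *)
Lemma apriori_bound_global_solution (R : realType) n (F : 'rV[R]_n -> 'rV[R]_n)
    (x0 : 'rV[R]_n) (M : R) :
  (exists K, forall x y, `|x| <= M -> `|y| <= M ->
     `|F x - F y| <= K * `|x - y|) ->
  (forall (T : R) (y : R -> 'rV[R]_n), 0 <= T -> continuous y -> y 0 = x0 ->
     (forall t, t \in `]0, T[ -> is_derive t 1 y (F (y t))) -> `|y T| < M) ->
  exists2 y, trajectory F y & y 0 = x0.
Proof.
move=> [K FK] bounded.
have M0 : 0 <= M.
  apply/ltW/(le_lt_trans (normr_ge0 x0)).
  have cst0 : continuous (fun _ : R => x0) by move=> t; exact: cst_continuous.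
  apply: (bounded 0 _ (lexx 0) cst0 erefl) => t.
  by rewrite in_itv/= => /andP[t0 /(lt_trans t0)]; rewrite ltxx.
have FMK x y : `|F (clamp M x) - F (clamp M y)| <= (`|K| + 1) * `|x - y|.
  apply: (le_trans (FK _ _ (clamp_norm _ M0) (clamp_norm _ M0))).
  apply: (@le_trans _ _ ((`|K| + 1) * `|clamp M x - clamp M y|)).
    by rewrite ler_wpM2r// (le_trans (ler_norm K))// lerDl.
  by rewrite ler_wpM2l ?clamp_lipschitz// addr_ge0.
have K1 : 1 <= `|K| + 1 by rewrite lerDr.
have [y [cy y0 dy]] := lipschitz_global_solution x0 K1 FMK.
have inside t : 0 <= t -> `|y t| < M.
  move=> t0; rewrite ltNge; apply/negP => yt.
  pose A := [set s : R | s \in `[0, t] /\ M <= `|y s|].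
  have A0 : A !=set0 by exists t; split=> //; rewrite in_itv/= t0 lexx.
  have cA : compact A.
    apply: (@subclosed_compact _ _ `[0, t]%classic); last first.
    - by move=> s [].
    - exact: segment_compact.
    - apply: closedI; first exact: itv_closed.
      apply: (@closed_comp _ _ (fun s => `|y s|) [set r | M <= r]).
        move=> s _; apply: (@continuous_comp _ _ _ y (fun v => `|v|)).
          exact: cy.
        exact: norm_continuous.
      exact: closed_ge.
  (* T is the first time in [0, t] at which the norm is at least M. *)
  have [T /set_mem[T0t yT] Tmin] := compact_EVT_min A0 cA
    (continuous_subspaceT (fun s => @cvg_id _ (nbhs s))).
  move: T0t; rewrite in_itv/= => /andP[T0 Tt].
  suff : `|y T| < M by rewrite ltNge yT.
  apply: bounded => // s; rewrite in_itv/= => /andP[s0 sT].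
  rewrite -(@clamp_id _ _ M (y s)); first exact: dy.
  rewrite leNgt; apply/negP => ys; suff : T <= s by rewrite leNgt sT.
  apply: Tmin; rewrite inE; split; last exact: ltW.
  by rewrite in_itv/= !ltW// (lt_le_trans sT Tt).
exists y => //; split; first exact: continuous_subspaceT.
move=> t t0; rewrite -(@clamp_id _ _ M (y t)); first exact: dy.
by rewrite ltW// inside// ltW.
Qed.

(** * Lyapunov's direct method *)

Lemma coercive_sublevel_compact (R : realType) n (W : 'rV[R]_n -> R) (a b : R) :
  continuous W -> coercive W -> compact [set x | a <= W x <= b].
Proof.
move=> cW coW; apply: bounded_closed_compact.
  have [r rW] := coW (b + 1).
  exists r; split=> [|M rM x /= /andP[_ xb]]; first exact: num_real.
  apply/ltW/(lt_trans _ rM); rewrite ltNge; apply/negP => /rW.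
  by move=> /le_trans/(_ xb); lra.
have -> : [set x | a <= W x <= b] = W @^-1` `[a, b].
  by apply/seteqP; split=> x /=; rewrite in_itv.
by apply: closed_comp; [move=> x _; exact: cW|exact: itv_closed].
Qed.

Lemma coercive_minimizer (R : realType) n (W : 'rV[R]_n -> R) :
  continuous W -> coercive W -> exists u, forall x, W u <= W x.
Proof.
move=> cW coW; have [r rW] := coW (W 0).
have S0 : [set x : 'rV[R]_n | 0 <= `|x| <= Num.max r 0] !=set0.
  by exists 0; rewrite /= normr0 lexx le_max lexx orbT.
have [u /set_mem uS umin] := EVT_min_rV S0 (@norm_shell_compact _ _ _ _)
  (continuous_subspaceT cW).
exists u => x; have [xr|xr] := leP `|x| (Num.max r 0).
  by apply: umin; rewrite inE/= normr_ge0.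
apply: (@le_trans _ _ (W 0)).
  by apply: umin; rewrite inE/= normr0 lexx le_max lexx orbT.
by apply: rW; move: xr; rewrite gt_max => /andP[/ltW].
Qed.

(** DW stands for the derivative of W along F, but all that is used of the
differential structure of W is the chain rule along solutions [dW]. *)
Section Lyapunov.
Variables (R : realType) (n : nat) (F : 'rV[R]_n -> 'rV[R]_n).
Variables (W DW : 'rV[R]_n -> R).
Hypotheses (cW : continuous W) (coW : coercive W).
Hypothesis W_gt : forall x, x != 0 -> W 0 < W x.
Hypothesis dW : forall (x : R -> 'rV[R]_n) (t : R), is_derive t 1 x (F (x t)) ->
  is_derive t 1 (fun s => W (x s)) (DW (x t)).
Hypotheses (cDW : continuous DW) (DW_le0 : forall x, DW x <= 0)
  (DW_lt0 : forall x, x != 0 -> DW x < 0).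

Lemma lyapunov_increment (x : R -> 'rV[R]_n) (a b k : R) : a <= b ->
  {within `[a, b], continuous x} ->
  (forall t, t \in `]a, b[ -> is_derive t 1 x (F (x t))) ->
  (forall t, t \in `]a, b[ -> DW (x t) <= k) ->
  W (x b) - W (x a) <= k * (b - a).
Proof.
move=> ab cx dx xk.
apply: (@increment_le _ (fun t => W (x t)) (fun t => DW (x t))) => //.
- by move=> t tab; apply: dW; exact: dx.
- by apply: (@within_continuous_comp _ _ _ _ x W) => // v _; exact: cW.
Qed.

Lemma lyapunov_noninc (x : R -> 'rV[R]_n) (a b : R) : 0 <= a -> a <= b ->
  trajectory F x -> W (x b) <= W (x a).
Proof.
move=> a0 ab [cx dx]; rewrite -subr_le0 -(mul0r (b - a)).
apply: lyapunov_increment => // [|t].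
  apply: continuous_subspaceW cx => t /=; rewrite !in_itv/= andbT => /andP[+ _].
  exact: le_trans.
by rewrite in_itv/= => /andP[+ _] => /(le_lt_trans a0); exact: dx.
Qed.

(** Where the norm is at least e, W is above W 0 + 1 far from the origin and at
least its minimum W u > W 0 on the remaining compact shell. *)
Lemma lyapunov_gap (e : R) : 0 < e ->
  exists2 m, W 0 < m & forall x, W x < m -> `|x| < e.
Proof.
move=> e0; have [r rW] := coW (W 0 + 1).
pose S := [set x : 'rV[R]_n | e <= `|x| <= r].
have [S0|/forallNP S0] := pselect (S !=set0); last first.
  exists (W 0 + 1); first by rewrite ltrDl.
  move=> x xm; rewrite ltNge; apply/negP => ex; apply: (S0 x).
  rewrite /S/= ex/= leNgt; apply/negP => /ltW/rW.
  by rewrite leNgt xm.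
have [u /set_mem/= /andP[eu _] umin] := EVT_min_rV S0
  (@norm_shell_compact _ _ _ _) (continuous_subspaceT cW).
exists (Num.min (W 0 + 1) (W u)).
  by rewrite lt_min ltrDl ltr01/= W_gt// -normr_gt0 (lt_le_trans e0).
move=> x; rewrite lt_min => /andP[x1 xu]; rewrite ltNge; apply/negP => ex.
have [xr|/ltW/rW] := leP `|x| r; last by rewrite leNgt x1.
suff : W u <= W x by rewrite leNgt xu.
by apply: umin; rewrite inE /S/= ex xr.
Qed.

(** The value m of [lyapunov_gap] bounds W from below at all points of norm at
least e, not only on the sphere, so W < m alone confines the trajectory to the
ball of radius e. *)
Lemma lyapunov_is_stable : lyapunov_stable F.
Proof.
move=> e e0; have [m m0 mW] := lyapunov_gap e0.
have /nbhs_ballP[d /= d0 dWm] : \forall x \near (0 : 'rV[R]_n), W x < m.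
  have := (cvgrPdist_lt _ _).1 (@cW 0) (m - W 0).
  rewrite subr_gt0 => /(_ _ m0); apply: filterS => y.
  by rewrite distrC => /(le_lt_trans (ler_norm _)); rewrite ltrD2r.
exists d => // x xT x0 t t0; apply: mW.
apply: le_lt_trans (lyapunov_noninc (lexx 0) t0 xT) _.
by apply: dWm; rewrite mx_norm_ball /ball_/= sub0r normrN.
Qed.

(** Otherwise the trajectory stays in the compact set m <= W <= W (x 0), which
avoids the origin; DW has there a maximum DW u < 0, so W loses at least
- DW u per unit of time and drops below its minimum W 0. *)
Lemma lyapunov_reaches (x : R -> 'rV[R]_n) (m : R) :
  trajectory F x -> W 0 < m -> exists2 T, 0 <= T & W (x T) < m.
Proof.
move=> xT m0; apply: contrapT => /forall2NP noT.
have stay t : 0 <= t -> m <= W (x t) <= W (x 0).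
  move=> t0; rewrite (lyapunov_noninc _ t0 xT)// andbT leNgt; apply/negP => h.
  by case: (noT t).
have S0 : [set y | m <= W y <= W (x 0)] !=set0 by exists (x 0); exact: stay.
have [u /set_mem/= /andP[mu _] umax] :=
  EVT_max_rV S0 (@coercive_sublevel_compact _ _ _ m (W (x 0)) cW coW)
    (continuous_subspaceT cDW).
have u0 : DW u < 0.
  by apply: DW_lt0; apply/eqP => u0; move: mu; rewrite u0 leNgt m0.
(* At this time the linear bound on W (x t) equals W 0 - 1. *)
pose t := (W (x 0) - W 0 + 1) / - DW u.
have gap0 : 0 <= W (x 0) - W 0.
  by have /andP[h1 _] := stay 0 (lexx 0); rewrite subr_ge0 (le_trans (ltW m0)).
have t0 : 0 <= t by rewrite /t divr_ge0 ?oppr_ge0 ?(ltW u0)// addr_ge0.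
have [cx dx] := xT.
have : W (x t) - W (x 0) <= DW u * (t - 0).
  apply: lyapunov_increment => // [|s|s].
  - apply: continuous_subspaceW cx => s /=; rewrite !in_itv/= andbT.
    by move=> /andP[].
  - by rewrite in_itv/= => /andP[s0 _]; exact: dx.
  - by rewrite in_itv/= => /andP[/ltW s0 _]; apply: umax; rewrite inE/= stay.
have -> : DW u * (t - 0) = - (W (x 0) - W 0 + 1).
  by have u0' := ltr0_neq0 u0; rewrite /t subr0; field.
have /andP[h1 h2] := stay t t0; lra.
Qed.

Lemma lyapunov_attractive (x : R -> 'rV[R]_n) : trajectory F x ->
  x t @[t --> +oo%R] --> (0 : 'rV[R]_n).
Proof.
move=> xT; apply/cvgrPdist_lt => e e0.
have [m m0 mW] := lyapunov_gap e0.
have [T T0 xTm] := lyapunov_reaches xT m0.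
near=> t; rewrite sub0r normrN; apply: mW; apply: le_lt_trans xTm.
by apply: lyapunov_noninc => //; near: t; exact: nbhs_pinfty_ge.
Unshelve. all: by end_near. Qed.

(** W does not increase, so the solution remains where W <= W x0, a set that
coercivity bounds independently of the time. *)
Lemma lyapunov_global_solution (x0 : 'rV[R]_n) :
  (forall M, exists K, forall x y, `|x| <= M -> `|y| <= M ->
     `|F x - F y| <= K * `|x - y|) ->
  exists2 x, trajectory F x & x 0 = x0.
Proof.
move=> FL; have [r rW] := coW (W x0 + 1).
apply: (@apriori_bound_global_solution _ _ _ _ r (FL r)) => T y T0 cy y0 dy.
rewrite ltNge; apply/negP => /rW.
suff : W (y T) - W (y 0) <= 0 * (T - 0) by rewrite y0; lra.
by apply: lyapunov_increment => //; exact: continuous_subspaceT.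
Qed.

End Lyapunov.

(** * Lyapunov functions of polynomial vector fields *)

Lemma vfield_lipschitz (R : realType) n (f : 'I_n -> mpoly n R) M :
  exists K, forall x y, `|x| <= M -> `|y| <= M ->
    `|vfield f x - vfield f y| <= K * `|x - y|.
Proof.
have /choice[K KP] i : exists K, 0 <= K /\ forall x y, `|x| <= M -> `|y| <= M ->
    `|peval (f i) x - peval (f i) y| <= K * `|x - y|.
  by have [K K0 KP] := peval_lipschitz (f i) M; exists K.
have K0 i : 0 <= K i by have [] := KP i.
exists (\sum_i K i) => x y xM yM; apply: row_norm_le => [|i].
  by rewrite mulr_ge0// sumr_ge0.
rewrite !mxE; apply: le_trans ((KP i).2 x y xM yM) _.
by rewrite ler_wpM2r// (bigD1 i)//= lerDl sumr_ge0.
Qed.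

Lemma peval_Vdot (R : comNzRingType) n (V : mpoly n R)
    (f : 'I_n -> mpoly n R) x :
  peval (Vdot V f) x = \sum_i peval (mderiv i V) x * vfield f x ord0 i.
Proof.
rewrite /Vdot /peval raddf_sum; apply: eq_bigr => i _.
by rewrite mxE; exact: mevalM.
Qed.

Lemma sos_peval_ge0 (R : realDomainType) n (p : mpoly n R) x :
  sos p -> 0 <= peval p x.
Proof.
move=> [s ->]; rewrite /peval raddf_sum sumr_ge0// => q _.
by rewrite expr2 [_ (_ * _)]mevalM -expr2 sqr_ge0.
Qed.

Lemma pevalN (R : nzRingType) n (p : mpoly n R) x : peval (- p) x = - peval p x.
Proof. exact: mevalN. Qed.

Lemma is_derive_peval_flow (R : realType) n (V : mpoly n R)
    (f : 'I_n -> mpoly n R) (x : R -> 'rV[R]_n) (t : R) :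
  is_derive t 1 x (vfield f (x t)) ->
  is_derive t 1 (fun s => peval V (x s)) (peval (Vdot V f) (x t)).
Proof. by rewrite peval_Vdot; exact: is_derive_peval. Qed.

(** Restricted to the line through u in the direction of the field at u, V has
a minimum at u, and its derivative there is [Vdot V f] at u. *)
Lemma Vdot_minimizer (R : realType) n (V : mpoly n R)
    (f : 'I_n -> mpoly n R) u :
  (forall x, peval V u <= peval V x) -> peval (Vdot V f) u = 0.
Proof.
move=> umin; pose g (s : R) := u + s *: vfield f u.
have dg (s : R) : is_derive s 1 g (vfield f u).
  apply: is_derive_row => i.
  have -> : (fun t => g t ord0 i) =
      (fun t => u ord0 i + vfield f u ord0 i *: t).
    by apply/funext => t; rewrite /g mxE [X in _ + X]mxE mulrC.
  rewrite -[X in is_derive _ _ _ X]add0r -[X in 0 + X]mulr1.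
  apply: is_deriveD.
have g0 : g 0 = u by rewrite /g scale0r addr0.
have dVg (s : R) := is_derive_peval V (dg s).
have d0 : is_derive (0 : R) 1 (fun s => peval V (g s)) 0.
  apply: (@derive1_at_min _ _ (-1) 1) => [ | | |t _].
  - lra.
  - by move=> t _; exact: (@ex_derive _ _ _ _ _ _ _ (dVg t)).
  - by rewrite in_itv/=; lra.
  - by rewrite g0.
have := dVg 0; rewrite g0 peval_Vdot => dVg0.
by rewrite -(@derive_val _ _ _ _ _ _ _ dVg0) (@derive_val _ _ _ _ _ _ _ d0).
Qed.

(** A constant V has derivative 0 along f, which is positive definite only if
there is no nonzero vector; coercivity is then vacuous. *)
Lemma lyapunov_candidate_coercive (R : realType) n (V : mpoly n R)
    (f : 'I_n -> mpoly n R) :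
  posdef (peval (thc V)) -> posdef (peval (- Vdot V f)) -> coercive (peval V).
Proof.
move=> hV hdV; have [V1|V1] := ltnP 1 (msize V).
  exact: thc_posdef_coercive.
move=> A; exists 1 => x x1.
have : 0 < peval (- Vdot V f) x.
  by apply: hdV; rewrite -normr_gt0; exact: lt_le_trans x1.
suff -> : Vdot V f = 0 by rewrite pevalN /peval meval0 oppr0 ltxx.
by rewrite /Vdot big1// => i _; rewrite (msize1_polyC V1) mderivC mul0r.
Qed.

Theorem lemma4p2 (R : realType) :
  (forall (n : nat) (f : 'I_n -> mpoly n R),
     vfield f 0 = 0 ->
     (exists V : mpoly n R,
        [/\ sos (thc V), posdef (peval (thc V)),
            sos (- Vdot V f) & posdef (peval (- Vdot V f))]) ->
     globally_asymptotically_stable (vfield f)) /\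
  (forall (n : nat) (V : mpoly n R), sos V -> sos (thc V)) /\
  (forall n : nat, (0 < n)%N ->
     exists V : mpoly n R, sos (thc V) /\ ~ sos V).
Proof.
split; last by split; [exact: sos_thc | exact: thc_sos_not_sos].
move=> n f _ [V [_ hV sosdV hdV]].
have coV := lyapunov_candidate_coercive hV hdV.
have cV := @peval_continuous _ _ V.
have cdV := @peval_continuous _ _ (Vdot V f).
have dV_le0 x : peval (Vdot V f) x <= 0.
  by rewrite -oppr_ge0 -pevalN; exact: sos_peval_ge0.
have dV_lt0 x : x != 0 -> peval (Vdot V f) x < 0.
  by move=> x0; rewrite -oppr_gt0 -pevalN; exact: hdV.
have min0 u : (forall x, peval V u <= peval V x) -> u = 0.
  move=> /(@Vdot_minimizer _ _ _ f) du0; apply/eqP/negPn/negP => /dV_lt0.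
  by rewrite du0 ltxx.
have V_gt x : x != 0 -> peval V 0 < peval V x.
  have [u umin] := coercive_minimizer cV coV.
  have u0 := min0 u umin; rewrite u0 in umin.
  move=> x0; rewrite lt_def umin andbT; apply/eqP => Vx.
  by move/eqP: x0; apply; apply: min0; rewrite Vx.
have dVf := @is_derive_peval_flow _ _ V f.
split.
- exact: lyapunov_is_stable cV coV V_gt dVf dV_le0.
- move=> x0; apply: (lyapunov_global_solution cV coV dVf dV_le0).
  exact: vfield_lipschitz.
- by move=> x; exact: lyapunov_attractive cV coV V_gt dVf cdV dV_le0 dV_lt0 _.
Qed.
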